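(* For any normal extension $L$ of $\mathbf{CL}$, $L$ is topologically complete if and only if $L$ is topologically strongly complete.
   Context: The language $\mathcal{L}(\Box,\rhd)$ has countably many propositional variables, $\top,\bot$, $\neg,\land,\lor,\to$, unary modal operators $\Box,\Diamond$ ($\Diamond$ dual of $\Box$) and a binary modal operator $\rhd$. $\mathbf{CL}$ is the smallest set of formulas containing all propositional tautologies, $\Box(p\to q)\to(\Box p\to\Box q)$, $\Box(\Box p\to p)\to\Box p$, J1: $\Box(p\to q)\to(p\rhd q)$; J2: $(p\rhd q)\land(q\rhd r)\to(p\rhd r)$; J3: $(p\rhd r)\land(q\rhd r)\to((p\lor q)\rhd r)$; J4: $(p\rhd q)\to(\Diamond p\to\Diamond q)$, closed under modus ponens, necessitation and substitution. A normal extension of $\mathbf{CL}$ is a set $L\supseteq\mathbf{CL}$ closed under these rules. $\Gamma\vdash_L\varphi$ means $\bigwedge\Gamma_0\to\varphi\in L$ for some finite $\Gamma_0\subseteq\Gamma$. For a topology $\tau$ on $X$, $d_\tau(Y)=\{x: \text{every } U\in\tau \text{ containing } x \text{ meets } Y\setminus\{x\}\}$ and $cd_\tau(Y)=X\setminus d_\tau(X\setminus Y)$. A bitopological space is $\langle X,\tau^0,\tau^1\rangle$ with $X\neq\varnothing$ and $\tau^0,\tau^1$ topologies on $X$. Set $e_{\tau^0,\tau^1}(Y,Z)=\{x:\forall U\in\tau^1[x\in d_{\tau^0}(Y\cap U)\Rightarrow x\in d_{\tau^0}(Z\cap U)]\}$. A valuation $v$ maps formulas to subsets of $X$, Boolean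 on connectives, with $v(\Box\varphi)=cd_{\tau^0}(v(\varphi))$, $v(\Diamond\varphi)=d_{\tau^0}(v(\varphi))$, $v(\varphi\rhd\psi)=e_{\tau^0,\tau^1}(v(\varphi),v(\psi))$. Validity means $v(\varphi)=X$ for all $v$; $\mathrm{Log}(X,\tau^0,\tau^1)$ is the set of valid formulas; an $L$-space is one with $L\subseteq\mathrm{Log}(X,\tau^0,\tau^1)$. $\Gamma\models_L^T\varphi$ means: in every $L$-space, for every valuation and point $x$, if $x\in v(\psi)$ for all $\psi\in\Gamma$ then $x\in v(\varphi)$. $L$ is topologically complete if $\varnothing\models_L^T\varphi$ implies $\varnothing\vdash_L\varphi$ for all $\varphi$, and topologically strongly complete if $\Gamma\models_L^T\varphi$ implies $\Gamma\vdash_L\varphi$ for all $\Gamma,\varphi$. *)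

(* Defs.v *)
From Stdlib Require List.
From mathcomp Require Import all_boot.
From mathcomp Require Import all_classical topology.

Set Implicit Arguments.
Unset Strict Implicit.
Unset Printing Implicit Defensive.

Local Open Scope classical_set_scope.

(** Syntax *)

Inductive form : Type :=
| Var of nat
| Top
| Bot
| Neg of form
| And of form & form
| Or of form & form
| Imp of form & form
| Box of form
| Rhd of form & form.

(* The dual of [Box]; [val_Dia] below shows that it denotes the derived-set
   operator of the first topology. *)
Definition Dia (A : form) : form := Neg (Box (Neg A)).

Fixpoint subst (s : nat -> form) (A : form) : form :=
  match A with
  | Var n => s n
  | Top => Top
  | Bot => Bot
  | Neg B => Neg (subst s B)
  | And B C => And (subst s B) (subst s C)
  | Or B C => Or (subst s B) (subst s C)
  | Imp B C => Imp (subst s B) (subst s C)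
  | Box B => Box (subst s B)
  | Rhd B C => Rhd (subst s B) (subst s C)
  end.

(* Truth-table evaluation: variables and formulas whose main connective is
   modal are treated as atoms, with truth values given by [a]. *)
Fixpoint truth (a : form -> bool) (A : form) : bool :=
  match A with
  | Top => true
  | Bot => false
  | Neg B => ~~ truth a B
  | And B C => truth a B && truth a C
  | Or B C => truth a B || truth a C
  | Imp B C => truth a B ==> truth a C
  | Var _ | Box _ | Rhd _ _ => a A
  end.

Definition tautology (A : form) : Prop := forall a, truth a A.

(** Logics *)

Local Notation p := (Var 0).
Local Notation q := (Var 1).
Local Notation r := (Var 2).

Inductive CL : set form :=
| CL_taut A : tautology A -> CL A
| CL_K : CL (Imp (Box (Imp p q)) (Imp (Box p) (Box q)))
| CL_L : CL (Imp (Box (Imp (Box p) p)) (Box p))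
| CL_J1 : CL (Imp (Box (Imp p q)) (Rhd p q))
| CL_J2 : CL (Imp (And (Rhd p q) (Rhd q r)) (Rhd p r))
| CL_J3 : CL (Imp (And (Rhd p r) (Rhd q r)) (Rhd (Or p q) r))
| CL_J4 : CL (Imp (Rhd p q) (Imp (Dia p) (Dia q)))
| CL_mp A B : CL (Imp A B) -> CL A -> CL B
| CL_nec A : CL A -> CL (Box A)
| CL_subst s A : CL A -> CL (subst s A).

Record normal_extension (L : set form) : Prop := {
  normal_CL : CL `<=` L;
  normal_mp : forall A B, L (Imp A B) -> L A -> L B;
  normal_nec : forall A, L A -> L (Box A);
  normal_subst : forall s A, L A -> L (subst s A) }.

Definition bigAnd (G : seq form) : form := foldr And Top G.

Definition derives (L Gamma : set form) (A : form) : Prop :=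
  exists G : seq form,
    (forall B, List.In B G -> Gamma B) /\ L (Imp (bigAnd G) A).

(** Bitopological semantics *)

(* [Topological X] is the type of topologies on [X]; the topological space it
   determines is [Topological.Pack tau]. *)
Definition opens (X : Type) (tau : Topological X) : set (set X) :=
  @open (Topological.Pack tau).

Definition der (X : Type) (tau : Topological X) (Y : set X) : set X :=
  @limit_point (Topological.Pack tau) Y.

Definition coder (X : Type) (tau : Topological X) (Y : set X) : set X :=
  ~` der tau (~` Y).

Definition eop (X : Type) (tau0 tau1 : Topological X) (Y Z : set X) : set X :=
  [set x | forall U, opens tau1 U ->
             der tau0 (Y `&` U) x -> der tau0 (Z `&` U) x].

Record bitopSpace : Type := BitopSpace {
  carrier :> Type;
  carrier_neq0 : [set: carrier] !=set0;
  top0 : Topological carrier;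
  top1 : Topological carrier }.

Fixpoint val (X : bitopSpace) (v : nat -> set X) (A : form) : set X :=
  match A with
  | Var n => v n
  | Top => setT
  | Bot => set0
  | Neg B => ~` val v B
  | And B C => val v B `&` val v C
  | Or B C => val v B `|` val v C
  | Imp B C => ~` val v B `|` val v C
  | Box B => coder (top0 X) (val v B)
  | Rhd B C => eop (top0 X) (top1 X) (val v B) (val v C)
  end.

Lemma val_Dia (X : bitopSpace) (v : nat -> set X) (A : form) :
  val v (Dia A) = der (top0 X) (val v A).
Proof. by rewrite /= /coder !setCK. Qed.

Lemma derE (X : Type) (tau : Topological X) (Y : set X) :
  der tau Y = [set x | forall U, opens tau U -> U x ->
                         U `&` (Y `\ x) !=set0].
Proof.
rewrite /der limit_pointEonbhs; apply/seteqP; split=> x /= H.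
  by move=> U oU Ux; rewrite setIC; apply: (H (Y `\ x) U).
by move=> A U YA [oU Ux]; have [y [Uy /YA Ay]] := H U oU Ux; exists y.
Qed.

Definition valid (X : bitopSpace) (A : form) : Prop :=
  forall v : nat -> set X, val v A = setT.

Definition Log (X : bitopSpace) : set form := [set A | valid X A].

Definition is_space_of (L : set form) (X : bitopSpace) : Prop := L `<=` Log X.

Definition top_consequence (L Gamma : set form) (A : form) : Prop :=
  forall X : bitopSpace, is_space_of L X ->
  forall (v : nat -> set X) (x : X),
    (forall B, Gamma B -> val v B x) -> val v A x.

Definition top_complete (L : set form) : Prop :=
  forall A, top_consequence L set0 A -> derives L set0 A.

Definition top_strongly_complete (L : set form) : Prop :=
  forall Gamma A, top_consequence L Gamma A -> derives L Gamma A.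

(* Main.v *)
(** If [L] does not derive [A] from [Gamma], completeness refutes
    [bigAnd G -> A] at a point [x_G] of an [L]-space [X_G] for every finite
    [G] included in [Gamma].  Add to the disjoint sum of the [X_G] a new point
    [*], whose punctured neighbourhoods are those that contain a punctured
    neighbourhood of [x_G] for almost all [G] with respect to an ultrafilter
    containing every set [{G | B in G}], [B] in [Gamma]; the second topology is
    that of the disjoint sum, with [*] put in or left out freely.  The summands
    are open, hence keep their truth values.  Loeb's axiom provides each [x_G]
    with an open neighbourhood that stays open when [x_G] is removed; therefore
    [*] is a limit point of [Y] iff almost every [x_G] is one of the trace of
    [Y] on [X_G], and a formula holds at [*] iff it holds at almost all [x_G].
    Hence the new space validates [L], and [*] satisfies [Gamma] but not
    [A]. *)

From HB Require Import structures.
Require Import Defs.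
From mathcomp Require Import all_boot.
From mathcomp Require Import all_classical topology.

Set Implicit Arguments.
Unset Strict Implicit.
Unset Printing Implicit Defensive.

Local Open Scope classical_set_scope.

(* MathComp's [val] of subtypes hides the valuation of formulas. *)
Local Notation val := Defs.val.

(** * Topologies given by their open sets *)

Section TopologyOfOpens.
Context (T : choiceType) (op : set (set T)) (opT : op setT)
  (opI : setI_closed op)
  (opU : forall (I : Type) (f : I -> set T),
    (forall i, op (f i)) -> op (\bigcup_i f i)).

(** The alias keeps the instance off [T] itself, since one carrier must bear two topologies; being
    convertible to [T], it still yields a [Topological T]. *)
Definition of_opens : Type := T.

HB.instance Definition _ := Choice.on of_opens.
HB.instance Definition _ := isOpenTopological.Build of_opens opT opI opU.

Definition topology_of_opens : Topological T := Topological.on of_opens.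

End TopologyOfOpens.

(** * Locality of limit points and of truth, and Loeb's axiom at a point *)

Section Opens.
Context (X : Type) (tau : Topological X).
Implicit Types (U V W Y Z : set X) (x y : X).

Lemma opensT : opens tau setT. Proof. exact: openT. Qed.

Lemma opens0 : opens tau set0. Proof. exact: open0. Qed.

Lemma opensI U V : opens tau U -> opens tau V -> opens tau (U `&` V).
Proof. exact: openI. Qed.

Lemma opens_bigcup (I : Type) (D : set I) (f : I -> set X) :
  (forall i, D i -> opens tau (f i)) -> opens tau (\bigcup_(i in D) f i).
Proof. exact: bigcup_open. Qed.

Lemma der_local W Y Z y : opens tau W -> W y ->
  (forall z, W z -> z <> y -> (Y z <-> Z z)) -> (der tau Y y <-> der tau Z y).
Proof.
move=> oW Wy YZ; rewrite !derE /=; split=> H U oU Uy.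
  have [z [[Uz Wz] [/YZ Zz zy]]] := H _ (opensI oU oW) (conj Uy Wy).
  by exists z; split=> //; split=> //; apply: Zz.
have [z [[Uz Wz] [Zz zy]]] := H _ (opensI oU oW) (conj Uy Wy).
by exists z; split=> //; split=> //; apply/YZ.
Qed.

(** Loeb's axiom for the closure [Y] of [x] keeps [x] from being a limit point of [Y], so some open
    [W] around [x] meets [Y] at most in [x]. The other points of [W] have open neighbourhoods that
    miss [x], and these make up the rest of [W]. *)
Lemma loeb_locally_closed x :
  (forall Y, der tau Y x -> der tau (Y `\` der tau Y) x) ->
  exists2 W, opens tau W & W x /\ opens tau (W `\ x).
Proof.
pose Y : set X := [set y | forall U, opens tau U -> U y -> U x].
move=> /(_ Y) loeb; have [dY|ndY] := pselect (der tau Y x).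
  (* Every [y <> x] in the closure [Y] of [x] is a limit point of [Y]. *)
  exfalso; have := loeb dY; rewrite derE => /(_ setT opensT I).
  move=> [y [_ [[Yy ndy] yx]]]; apply: ndy; rewrite derE => U oU Uy.
  by exists x; split; [exact: Yy Uy|split=> // xy; apply: yx].
move: ndY; rewrite derE /= -existsNP => -[W /not_implyP[oW /not_implyP[Wx WY]]].
exists W => //; split=> //.
have -> : W `\ x = \bigcup_(U in [set U | opens tau U /\ ~ U x]) (U `&` W).
  apply/seteqP; split=> [y [Wy yx]|y [U [oU Ux] [Uy Wy]]].
    have /existsNP[U /not_implyP[oU /not_implyP[Uy Ux]]] : ~ Y y.
      by move=> Yy; apply: WY; exists y.
    by exists U.
  by split=> // yx; apply: Ux; rewrite -yx.
by apply: opens_bigcup => U [oU _]; apply: opensI.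
Qed.

End Opens.

(** Truth is local in the first topology: the second only supplies sets [U] to intersect with, the
    same for both valuations, before limit points are taken. *)
Lemma val_agree (X : bitopSpace) (u v : nat -> set X) (W : set X) :
  opens (top0 X) W -> (forall n y, W y -> (u n y <-> v n y)) ->
  forall A y, W y -> (val u A y <-> val v A y).
Proof.
move=> oW uv; elim=> [n|||B IB|B IB C IC|B IB C IC|B IB C IC|B IB|B IB C IC] y Wy //=.
- exact: uv.
- by rewrite /setC /=; have := IB y Wy; tauto.
- by have := IB y Wy; have := IC y Wy; rewrite /setI /=; tauto.
- by have := IB y Wy; have := IC y Wy; rewrite /setU /=; tauto.
- by have := IB y Wy; have := IC y Wy; rewrite /setU /setC /=; tauto.
- rewrite /coder /setC /=; apply: not_iff_compat.
  by apply: (der_local oW Wy) => z Wz _; apply: not_iff_compat; apply: IB.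
- have E U D : (forall z, W z -> (val u D z <-> val v D z)) ->
      (der (top0 X) (val u D `&` U) y <-> der (top0 X) (val v D `&` U) y).
    move=> ID; apply: (der_local oW Wy) => z Wz _.
    by have := ID z Wz; rewrite /setI /=; tauto.
  by split=> H U oU; have := H U oU; have := E U _ IB; have := E U _ IC; tauto.
Qed.

(** * The bouquet of pointed spaces along an ultrafilter *)

Section Bouquet.
Context (I : eqType) (F : set (set I)) (FU : UltraFilter F)
  (X : I -> bitopSpace) (x : forall i, X i).

Lemma ultraN (P : set I) : F (~` P) <-> ~ F P.
Proof.
split=> [FnP FP'|nFP]; last by case: (in_ultra_setVsetC P FU).
by have [i []] := filter_ex (filterI FnP FP').
Qed.

Lemma ultraU (P Q : set I) : F (P `|` Q) <-> F P \/ F Q.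
Proof.
split=> [FPQ|[]]; last 2 first.
- by apply: filterS => i; left.
- by apply: filterS => i; right.
have [FP|FnP] := in_ultra_setVsetC P FU; first by left.
by right; apply: filterS (filterI FPQ FnP) => i [[]].
Qed.

Definition bouquet : Type := option {i : I & X i}.

Definition inc i (y : X i) : bouquet := Some (Tagged (fun i => X i : Type) y).

Lemma inc_inj i : injective (@inc i).
Proof. by move=> y z [/(@eq_from_Tagged _ X)]. Qed.

(** An open set around [None] need not contain any [x i]: as for derived sets, only the points near
    [x i] other than [x i] count. *)
Definition bouquet_op0 : set (set bouquet) :=
  [set U | (forall i, opens (top0 (X i)) (@inc i @^-1` U)) /\
    (U None -> F [set i | exists2 V, opens (top0 (X i)) V &
       V (x i) /\ V `\ x i `<=` @inc i @^-1` U])].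

(** With no condition at [None], open sets chosen independently in the summands glue to an open
    set. *)
Definition bouquet_op1 : set (set bouquet) :=
  [set U | forall i, opens (top1 (X i)) (@inc i @^-1` U)].

Lemma bouquet_op0T : bouquet_op0 setT.
Proof.
split=> [i|_]; first exact: opensT.
by apply: filterE => i; exists setT => //; apply: opensT.
Qed.

Lemma bouquet_op0I : setI_closed bouquet_op0.
Proof.
move=> U V [oU FUx] [oV FV]; split=> [i|[/FUx + /FV]]; first exact: opensI.
apply: filterS2 => i [U' oU' [Ux sU]] [V' oV' [Vx sV]].
exists (U' `&` V'); first exact: opensI.
by split=> // y [[/= ? ?] ?]; split; [apply: sU|apply: sV].
Qed.

Lemma bouquet_op0_bigU (J : Type) (f : J -> set bouquet) :
  (forall j, bouquet_op0 (f j)) -> bouquet_op0 (\bigcup_j f j).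
Proof.
move=> of_; split=> [i|[j _ /(proj2 (of_ j))]].
  by rewrite preimage_bigcup; apply: opens_bigcup => j _; case: (of_ j).
apply: filterS => i [V oV [Vx sV]]; exists V => //.
by split=> // y /sV; exists j.
Qed.

Lemma bouquet_op1T : bouquet_op1 setT.
Proof. by move=> i; apply: opensT. Qed.

Lemma bouquet_op1I : setI_closed bouquet_op1.
Proof. by move=> U V oU oV i; apply: opensI. Qed.

Lemma bouquet_op1_bigU (J : Type) (f : J -> set bouquet) :
  (forall j, bouquet_op1 (f j)) -> bouquet_op1 (\bigcup_j f j).
Proof.
by move=> of_ i; rewrite preimage_bigcup; apply: opens_bigcup => j _; apply: of_.
Qed.

Lemma bouquet_neq0 : [set: bouquet] !=set0. Proof. by exists None. Qed.

Definition bouquet_space : bitopSpace := BitopSpace bouquet_neq0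
  (@topology_of_opens {classic bouquet} _
     bouquet_op0T bouquet_op0I bouquet_op0_bigU)
  (@topology_of_opens {classic bouquet} _
     bouquet_op1T bouquet_op1I bouquet_op1_bigU).

Lemma opens_bouquet0 : opens (top0 bouquet_space) = bouquet_op0.
Proof. by []. Qed.

Lemma opens_bouquet1 : opens (top1 bouquet_space) = bouquet_op1.
Proof. by []. Qed.

Lemma preimage_image_inc i (V : set (X i)) : @inc i @^-1` (@inc i @` V) = V.
Proof.
by apply/seteqP; split=> [y [z Vz /inc_inj <-]|y Vy] //; exists y.
Qed.

Lemma preimage_image_inc_neq i j (V : set (X i)) : i <> j ->
  @inc j @^-1` (@inc i @` V) = set0.
Proof. by move=> ij; apply/seteqP; split=> // y [z _ [] /ij]. Qed.

Lemma opens0_inc i (V : set (X i)) : opens (top0 (X i)) V ->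
  opens (top0 bouquet_space) (@inc i @` V).
Proof.
rewrite opens_bouquet0 => oV; split=> [j|[] //].
have [ij|ij] := pselect (i = j); last first.
  by rewrite preimage_image_inc_neq //; apply: opens0.
by case: _ / ij; rewrite preimage_image_inc.
Qed.

Lemma opens1_inc i (V : set (X i)) : opens (top1 (X i)) V ->
  opens (top1 bouquet_space) (@inc i @` V).
Proof.
rewrite opens_bouquet1 => oV j.
have [ij|ij] := pselect (i = j); last first.
  by rewrite preimage_image_inc_neq //; apply: opens0.
by case: _ / ij; rewrite preimage_image_inc.
Qed.

Lemma der_inc (Y : set bouquet) i (y : X i) :
  der (top0 bouquet_space) Y (inc y) <-> der (top0 (X i)) (@inc i @^-1` Y) y.
Proof.
rewrite !derE /=; split=> H U oU Uy.
  have /(_ _)[|_ [[z Uz <-] [Yz zy]]] := H _ (opens0_inc oU); first by exists y.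
  by exists z; split=> //; split=> // zy'; apply: zy; rewrite zy'.
have [oUi _] := oU.
have [z [Uz [Yz zy]]] := H _ (oUi i) Uy.
by exists (inc z); split=> //; split=> // /inc_inj.
Qed.

Lemma eop_inc (Y Z : set bouquet) i (y : X i) :
  eop (top0 bouquet_space) (top1 bouquet_space) Y Z (inc y) <->
  eop (top0 (X i)) (top1 (X i)) (@inc i @^-1` Y) (@inc i @^-1` Z) y.
Proof.
split=> H U oU.
  have := H _ (opens1_inc oU).
  by rewrite !der_inc !preimage_setI preimage_image_inc.
by rewrite !der_inc !preimage_setI; apply: H; apply: oU.
Qed.

Lemma val_inc (v : nat -> set bouquet) A i :
  @inc i @^-1` @val bouquet_space v A = val (fun n => @inc i @^-1` v n) A.
Proof.
elim: A => //= [B <-|B <- C <-|B <- C <-|B <- C <-|B <-|B <- C <-] //.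
  rewrite /coder -preimage_setC; apply/seteqP.
  by split=> y; rewrite /setC /= der_inc.
by apply/seteqP; split=> y /eop_inc.
Qed.

(** * Limit points and truth at the centre of the bouquet *)

Context (x_locally_closed : forall i, exists2 W, opens (top0 (X i)) W &
  W (x i) /\ opens (top0 (X i)) (W `\ x i)).

Lemma der_None (Y : set bouquet) : der (top0 bouquet_space) Y None <->
  F [set i | der (top0 (X i)) (@inc i @^-1` Y) (x i)].
Proof.
split=> [dY|FD]; last first.
  rewrite derE => U [_ /[apply] FV].
  have [i [/=]] := filter_ex (filterI FD FV).
  rewrite derE => dY [V oV [Vx sV]].
  have [y [Vy [Yy yx]]] := dY V oV Vx.
  by exists (inc y); split; [exact: sV|split].
apply: contrapT => /ultraN FD; move: dY; rewrite derE.
(* [U] is the largest open set that avoids [Y] and [None]. Adding [None] keeps it open: where [x i]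
   is no limit point of the trace of [Y], local closedness gives an open punctured neighbourhood
   that avoids [Y], hence lies in [U], even if [x i] itself is in [Y]. *)
pose S := [set W : set bouquet |
  opens (top0 bouquet_space) W /\ W `<=` ~` Y `\ None].
pose U := \bigcup_(W in S) W.
have oU : opens (top0 bouquet_space) U by apply: opens_bigcup => W [].
have UN i : @inc i @^-1` (None |` U) = @inc i @^-1` U.
  by apply/seteqP; split=> y /=; [case|right].
move=> /(_ (None |` U)) []; last 2 first.
- by left.
- by move=> z [[->|[W [_ sW] Wz]] [Yz zN]]; [apply: zN|have [] := sW _ Wz].
split=> [i|_]; first by rewrite UN; apply: (proj1 oU).
apply: filterS FD => i; rewrite /setC /= derE /= -existsNP.
move=> [V /not_implyP[oV /not_implyP[Vx VY]]].
have [W oW [Wx oWx]] := x_locally_closed i.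
exists (V `&` W); first exact: opensI.
split=> // y [[Vy Wy] yx]; rewrite UN.
exists (@inc i @` (V `&` (W `\ x i))); last by exists y.
split; first by apply: opens0_inc; apply: opensI.
by move=> _ [z [Vz [Wz zx]] <-]; split=> // Yz; apply: VY; exists z.
Qed.

Lemma eop_None (Y Z : set bouquet) :
  eop (top0 bouquet_space) (top1 bouquet_space) Y Z None <->
  F [set i | eop (top0 (X i)) (top1 (X i))
               (@inc i @^-1` Y) (@inc i @^-1` Z) (x i)].
Proof.
split=> [eYZ|FE U oU].
  apply: contrapT => /ultraN FE.
  (* Where the relation fails at [x i], [V] witnesses the failure; elsewhere [setT] is a default.
     The union [U] of the images of these sets then contradicts [eYZ]. *)
  have Vex i : exists V, opens (top1 (X i)) V /\
      (~ eop (top0 (X i)) (top1 (X i)) (@inc i @^-1` Y) (@inc i @^-1` Z) (x i)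
      -> der (top0 (X i)) (@inc i @^-1` Y `&` V) (x i) /\
         ~ der (top0 (X i)) (@inc i @^-1` Z `&` V) (x i)).
    have [e|] := pselect (eop (top0 (X i)) (top1 (X i))
                            (@inc i @^-1` Y) (@inc i @^-1` Z) (x i)).
      by exists setT; split=> //; apply: opensT.
    by move=> /existsNP[V /not_implyP[oV /not_implyP[dY dZ]]]; exists V.
  pose V i := sval (cid (Vex i)).
  have VP i : opens (top1 (X i)) (V i) /\ _ := svalP (cid (Vex i)).
  pose U := \bigcup_i @inc i @` V i.
  have UE i : @inc i @^-1` U = V i.
    rewrite /U preimage_bigcup; apply/seteqP; split=> [y [j _]|y Vy]; last first.
      by exists i => //; rewrite preimage_image_inc.
    have [ji|ji] := pselect (j = i); last by rewrite preimage_image_inc_neq.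
    by subst j; rewrite preimage_image_inc.
  have oU : opens (top1 bouquet_space) U.
    by apply: opens_bigcup => i _; apply: opens1_inc; case: (VP i).
  have /der_None FZ : der (top0 bouquet_space) (Z `&` U) None.
    apply: (eYZ U oU); apply/der_None; apply: filterS FE => i nE /=.
    by rewrite preimage_setI UE; have [_ /(_ nE) []] := VP i.
  have [i [/= nE]] := filter_ex (filterI FE FZ).
  by rewrite preimage_setI UE; have [_ /(_ nE) []] := VP i.
rewrite !der_None; apply: filterS2 FE => i /= e; rewrite !preimage_setI.
exact: e.
Qed.

(* Los's theorem at the centre of the bouquet.  The valuations [u i] may differ
   from the restrictions of [v] at the base points [x i], where they have to
   follow the value of [v] at [None]. *)
Lemma val_None (v : nat -> set bouquet) (u : forall i, nat -> set (X i)) :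
    (forall i n y, y <> x i -> (u i n y <-> v n (inc y))) ->
    (forall n, v n None <-> F [set i | u i n (x i)]) ->
  forall A, @val bouquet_space v A None <-> F [set i | val (u i) A (x i)].
Proof.
move=> uv vN.
(* The valuations agree on a punctured neighbourhood of [x i] that is open, so [val_agree] extends
   the agreement to all formulas there. Derived sets at [x i] see nothing more. *)
have agree A i : exists2 W, opens (top0 (X i)) W & W (x i) /\
    forall y, W y -> y <> x i -> (val (u i) A y <-> @val bouquet_space v A (inc y)).
  have [W oW [Wx oWx]] := x_locally_closed i.
  exists W => //; split=> // y Wy yx.
  have -> : @val bouquet_space v A (inc y) = val (fun n => @inc i @^-1` v n) A y.
    by rewrite -val_inc.
  by apply: (val_agree oWx) => // n z [_ zx]; apply: uv.
have iffF (P Q : set I) : (forall i, P i <-> Q i) -> (F P <-> F Q).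
  by move=> PQ; split; apply: filterS => i /PQ.
elim=> [n|||B IB|B IB C IC|B IB C IC|B IB C IC|B IB|B IB C IC] /=.
- exact: vN.
- by split=> // _; apply: filterE.
- by split=> // F0; apply: (@filter_not_empty _ F).
- by rewrite /setC /= IB -ultraN.
- split=> [[/IB FB /IC FC]|FBC]; first exact: filterI.
  by split; [apply/IB|apply/IC]; apply: filterS FBC => i [].
- by rewrite /setU /= IB IC -ultraU.
- by rewrite /setU /setC /= IB IC -ultraN -ultraU.
- rewrite /coder /setC /= der_None -ultraN; apply: iffF => i /=.
  have [W oW [Wx uvB]] := agree B i.
  apply: not_iff_compat; apply: (der_local oW Wx) => y Wy yx.
  by have := uvB y Wy yx; rewrite /preimage /setC /=; tauto.
- rewrite eop_None; apply: iffF => i /=.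
  have E D V : der (top0 (X i)) (@inc i @^-1` @val bouquet_space v D `&` V) (x i)
      <-> der (top0 (X i)) (val (u i) D `&` V) (x i).
    have [W oW [Wx uvD]] := agree D i.
    apply: (der_local oW Wx) => y Wy yx.
    by have := uvD y Wy yx; rewrite /preimage /setI /=; tauto.
  by split=> H V oV; have := H V oV; rewrite !E.
Qed.

Lemma bouquet_is_space_of (L : set form) :
  (forall i, is_space_of L (X i)) -> is_space_of L bouquet_space.
Proof.
move=> LX A LA v; apply/seteqP; split=> // -[[i y]|] _.
  have -> : @val bouquet_space v A (inc y) = val (fun n => @inc i @^-1` v n) A y.
    by rewrite -val_inc.
  by rewrite (LX i A LA).
(* [u] copies the value at [None] to every base point, so the indices where a variable holds are all
   or none, as [val_None] needs for an arbitrary [v]. *)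
pose u i n y := if pselect (y = x i) then v n None else v n (@inc i y).
have uv i n y : y <> x i -> (u i n y <-> v n (inc y)).
  by rewrite /u; case: pselect.
have uN i n : u i n (x i) = v n None by rewrite /u; case: pselect.
have vN n : v n None <-> F [set i | u i n (x i)].
  split=> [vn|Fu]; first by apply: filterE => i /=; rewrite uN.
  by have [i] := filter_ex Fu; rewrite /= uN.
apply/(val_None uv vN); apply: filterE => i /=.
by rewrite (LX i A LA).
Qed.

End Bouquet.

(** * From completeness to finite refutations and strong completeness *)

Section Derivations.
Context (L : set form) (hL : normal_extension L).

Lemma normal_taut A : tautology A -> L A.
Proof. by move=> tA; apply: normal_CL hL _ _; apply: CL_taut. Qed.

Lemma derives0 A : derives L set0 A -> L A.
Proof.
move=> [[|B G] [G0 LA]]; last by case: (G0 B); left.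
by apply: normal_mp hL _ _ LA _; apply: normal_taut.
Qed.

Lemma space_locally_closed (X : bitopSpace) (x : X) : is_space_of L X ->
  exists2 W, opens (top0 X) W & W x /\ opens (top0 X) (W `\ x).
Proof.
move=> LX; apply: loeb_locally_closed => Y.
(* With the variable read as the complement of [Y], the contrapositive of Loeb's axiom is the
   hypothesis of [loeb_locally_closed]. *)
have := LX _ (normal_CL hL CL_L) (fun=> ~` Y).
move=> /seteqP[_ /(_ x I)] /=; rewrite /coder !setCU !setCK.
by rewrite setIC -setDE => -[/contrapT|].
Qed.

End Derivations.

Lemma val_bigAnd (X : bitopSpace) (v : nat -> set X) (G : seq form) (x : X) :
  val v (bigAnd G) x <-> forall B, List.In B G -> val v B x.
Proof.
elim: G => [|B G IG] //=; split=> [[Bx /IG Gx] C [<-|/Gx]|H] //.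
by split; [apply: H; left|apply/IG => C CG; apply: H; right].
Qed.

Lemma complete_finite_refutation (L Gamma : set form) (A : form) :
    normal_extension L -> top_complete L -> ~ derives L Gamma A ->
  forall G : seq form, (forall B, List.In B G -> Gamma B) ->
  exists X : bitopSpace, is_space_of L X /\ exists (v : nat -> set X) (x : X),
    (forall B, List.In B G -> val v B x) /\ ~ val v A x.
Proof.
move=> hL cL nA G GGamma; apply: contrapT => nX; apply: nA.
exists G; split=> //; apply: (derives0 hL); apply: cL => X LX v x _ /=.
have [/val_bigAnd Gx|] := pselect (val v (bigAnd G) x); last by left.
right; apply: contrapT => nAx; apply: nX; exists X; split=> //.
by exists v, x.
Qed.

Theorem theorem4p14 (L : set form) (hL : normal_extension L) :
  top_complete L <-> top_strongly_complete L.
Proof.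
split=> [cL Gamma A GammaA|scL A]; last exact: scL.
apply: contrapT => nA.
pose I : eqType := {classic {G : seq form | forall B, List.In B G -> Gamma B}}.
pose mk G GG : I :=
  exist (fun G : seq form => forall B, List.In B G -> Gamma B) G GG.
(* Space, valuation and point are packed together so that one choice function provides all three. *)
pose model := {X : bitopSpace & ((nat -> set X) * X)%type}.
have /choice[M MP] (G : I) : exists M : model, is_space_of L (projT1 M) /\
    (forall B, List.In B (sval G) -> val (projT2 M).1 B (projT2 M).2) /\
    ~ val (projT2 M).1 A (projT2 M).2.
  have [X [LX [v [x vx]]]] := complete_finite_refutation hL cL nA (svalP G).
  by exists (existT _ X (v, x)).
pose X G := projT1 (M G); pose x G : X G := (projT2 (M G)).2.
pose w G : nat -> set (X G) := (projT2 (M G)).1.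
(* Concatenation of lists gives a set [above K] inside any two given ones, and each [above G]
   contains [G]; hence they generate a proper filter. *)
pose above (G : I) := [set H : I | forall B, List.In B (sval G) -> List.In B (sval H)].
have FP : ProperFilter (filter_from [set: I] above).
  apply: filter_from_proper => [|G _]; last by exists G.
  apply: filter_fromT_filter.
    by exists (mk [::] (fun B => False_ind _)).
  move=> [G GG] [H HG]; have GHG B : List.In B (G ++ H) -> Gamma B.
    by move=> /(List.in_app_or G H)[/GG|/HG].
  exists (mk (G ++ H) GHG) => K /= GHK.
  by split=> B BG; apply: GHK; apply: (List.in_or_app G H); [left|right].
have [F [FU sF]] := ultraFilterLemma FP.
have lc G := space_locally_closed hL (x G) (proj1 (MP G)).
have LB : is_space_of L (bouquet_space FU x) :=
  bouquet_is_space_of lc (fun G => proj1 (MP G)).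
(* At [None] a variable holds by decree when it holds at almost all base points, so [val_None]
   applies with the original valuations [w]. *)
pose v n : set (bouquet X) := [set z | match z with
  | Some (existT G y) => w G n y
  | None => F [set G | w G n (x G)] end].
have vP B : @val (bouquet_space FU x) v B None <-> F [set G | val (w G) B (x G)].
  exact: val_None.
have : @val (bouquet_space FU x) v A None.
  apply: GammaA => // B GB; apply/vP; apply: sF.
  have GB1 C : List.In C [:: B] -> Gamma C by case=> // <-.
  (* Every index above the one-element list of [B] has a model whose base point satisfies [B], so
     the set of such indices is in the generated filter. *)
  exists (mk [:: B] GB1) => // H /= BH.
  by have [_ [HB _]] := MP H; apply: HB; apply: BH; left.
by move=> /vP FA; have [G /=] := filter_ex FA; have [_ [_]] := MP G.
Qed.
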